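(* Let $G=\mathrm{GL}_{r+1}$, let $(r_1\cdots r_a)$ be a general partition of $r+1$ (positive integers with sum $r+1$, not required to be in non-increasing order), and let $P$ be the standard parabolic subgroup of $G$ with Levi subgroup $\mathrm{GL}_{r_1}\times\cdots\times\mathrm{GL}_{r_a}$. Then the map $$\pi_{(r_1\cdots r_a)}:D_{(r_1\cdots r_a)}\to W(P)\backslash W(G),$$ which sends a tableau to the coset of the Weyl group element $\Pi_2\cdots\Pi_a$, is a bijection.
   Context: $W(G)\cong S_{r+1}$ is generated by the simple reflections $s_1,\dots,s_r$ (usual labeling, $s_i\leftrightarrow(i,i+1)$). $P$ is block upper triangular, its Levi being embedded by $(g_1,\dots,g_a)\mapsto\mathrm{diag}(g_1,\dots,g_a)$; $W(P)$ is the subgroup of $W(G)$ generated by the simple reflections in the Levi. $W(P)\backslash W(G)$ is the set of cosets $W(P)w$. Consider the diagram with $a$ columns, the $j$th column having $r_j$ boxes, filled with symbols $k_0,k_1,\dots,k_r$ from top to bottom in columns, from the leftmost column to the rightmost. Thus the $j$th column contains, from top to bottom, $k_{r_1+\cdots+r_{j-1}},\dots,k_{r_1+\cdots+r_j-1}$. Delete the entries of the first column. $D_{(r_1\cdots r_a)}$ is the set of such fillings, i.e. of tuples $(k_{r_1},\dots,k_r)$, satisfying: (a) $k_i\in\mathbb{Z}$ and $1\le k_i\le i+1$; (b) the entries in each column $j\ge2$ are strictly increasing from top to bottom. For each $i$ put $\pi_{k_i}=s_is_{i-1}\cdots s_{k_i}$ if $1\le k_i\le i$ and $\pi_{k_i}=e$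 if $k_i=i+1$. For $2\le j\le a$, $\Pi_j$ is the product of the $\pi_{k_i}$ in the $j$th column in increasing order of $i$: $\Pi_j=\pi_{k_{r_1+\cdots+r_{j-1}}}\cdots\pi_{k_{r_1+\cdots+r_j-1}}$. *)

(* Defs.v *)
From mathcomp Require Import all_boot all_fingroup.

Set Implicit Arguments.
Unset Strict Implicit.
Unset Printing Implicit Defensive.

Local Open Scope group_scope.

Definition general_partition (n : nat) (rs : seq nat) : bool :=
  all (fun m => 0 < m)%N rs && (sumn rs == n).

(* Columns are numbered from 0 here, so that the column called j in prose
   (1 <= j <= a) has number j - 1. Column j holds the boxes k_i with
   col_start rs j <= i < col_start rs j.+1, that is k_0, ..., k_(r_1 - 1) in
   column 0, and so on. *)
Definition col_start (rs : seq nat) (j : nat) : nat := sumn (take j rs).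

(* The Weyl group of GL_(r+1) is 'S_r.+1, acting on {0, ..., r} instead of
   {1, ..., r+1}; for 1 <= i <= r the reflection s_i, usually written
   (i, i+1), exchanges i - 1 and i. MathComp composes permutations from left
   to right; as inversion is an isomorphism onto the opposite group that fixes
   every s_i, words in the s_i and cosets W(P)w have the same meaning with
   either convention. *)
Definition simple_refl (r i : nat) : 'S_r.+1 := tperm (inord i.-1) (inord i).

(* The 0-based basis indices p and q lie in the same diagonal block of the
   Levi subgroup diag(g_1, ..., g_a), g_j in GL_(r_j). *)
Definition same_block (rs : seq nat) (p q : nat) : bool :=
  [exists j : 'I_(size rs),
     (col_start rs j <= p < col_start rs j.+1)%N
     && (col_start rs j <= q < col_start rs j.+1)%N].

Definition weyl_P (r : nat) (rs : seq nat) : {group 'S_r.+1} :=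
  <<[set simple_refl r i | i : 'I_r.+1 & (0 < i)%N && same_block rs i.-1 i]>>%G.

Section Tableaux.

Variables (r : nat) (rs : seq nat).

(* A filling of the diagram without its first column is the tuple
   (k_(r_1), ..., k_r); entry k i is k_i for r_1 <= i <= r. *)
Definition filling := (r.+1 - head 0%N rs).-tuple nat.

Definition entry (k : filling) (i : nat) : nat := nth 0%N k (i - head 0%N rs).

Definition column (k : filling) (j : nat) : seq nat :=
  [seq entry k i | i <- index_iota (col_start rs j) (col_start rs j.+1)].

Definition is_tableau (k : filling) : bool :=
  [forall i : 'I_r.+1, (head 0 rs <= i)%N ==> (1 <= entry k i <= i.+1)%N]
  && [forall j : 'I_(size rs), (0 < j)%N ==> sorted ltn (column k j)].

Definition tableau := {k : filling | is_tableau k}.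

(* s_i s_(i-1) ... s_k if k <= i, and the empty product if k = i + 1. *)
Definition pi_elt (i k : nat) : 'S_r.+1 :=
  \prod_(m <- rev (index_iota k i.+1)) simple_refl r m.

Definition col_prod (k : filling) (j : nat) : 'S_r.+1 :=
  \prod_(col_start rs j <= i < col_start rs j.+1) pi_elt i (entry k i).

Definition tableau_prod (k : filling) : 'S_r.+1 :=
  \prod_(1 <= j < size rs) col_prod k j.

Definition weyl_cosets :=
  {C : {set 'S_r.+1} | C \in rcosets (weyl_P r rs) [set: 'S_r.+1]}.

Fact coset_subproof (w : 'S_r.+1) :
  weyl_P r rs :* w \in rcosets (weyl_P r rs) [set: 'S_r.+1].
Proof. by apply/rcosetsP; exists w; rewrite ?inE. Qed.

Definition weyl_coset (w : 'S_r.+1) : weyl_cosets :=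
  exist _ (weyl_P r rs :* w) (coset_subproof w).

Definition tableau_coset (k : tableau) : weyl_cosets :=
  weyl_coset (tableau_prod (val k)).

End Tableaux.

(* Main.v *)
(** Permutations act on the right, so [pi_elt r i k] sends [i] to [k - 1] and is
    increasing on [0, i). Hence every permutation of {0, ..., r} is, in exactly
    one way, a product pi_0 pi_1 ... pi_r with 1 <= k_i <= i + 1, and its values
    at [i] and [i + 1] compare in the same way as [k_i] and [k_(i+1)]. Tableaux
    therefore correspond to the permutations that are increasing on every block
    of the Levi subgroup, the first column being forced to be k_i = i + 1.
    Every coset of W(P) contains exactly one such permutation. *)
Require Import Defs.
From mathcomp Require Import all_boot all_fingroup.
From mathcomp Require Import zify.

Set Implicit Arguments.
Unset Strict Implicit.
Unset Printing Implicit Defensive.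

Local Open Scope group_scope.

Local Ltac case_ifs := do ?[case: ifP]; lia.

(** * Simple reflections and the words [pi_elt] as maps on points *)

Lemma simple_reflE r i (x : 'I_r.+1) : (0 < i <= r)%N ->
  simple_refl r i x =
    (if x == i.-1 :> nat then i else if x == i :> nat then i.-1 else x) :> nat.
Proof.
move=> i_bd; have := inordK (m := i) (n' := r); have := inordK (m := i.-1) (n' := r).
move=> vp vi; have {}vp := vp ltac:(lia); have {}vi := vi ltac:(lia).
rewrite /simple_refl; case: tpermP => [->|->|/eqP nxp /eqP nxi].
- by rewrite vp vi eqxx.
- by rewrite vp vi eqxx; case: eqP => // ->; lia.
- by rewrite -!val_eqE /= vp vi in nxp nxi; rewrite (negPf nxp) (negPf nxi).
Qed.

Lemma pi_elt_id r i : pi_elt r i i.+1 = 1.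
Proof. by rewrite /pi_elt /index_iota subnn big_nil. Qed.

Lemma pi_eltS r i k : (k <= i.+1)%N ->
  pi_elt r i.+1 k = simple_refl r i.+1 * pi_elt r i k.
Proof.
move=> le_ki; rewrite /pi_elt /index_iota subSn // -(addn1 (i.+1 - k)) iotaD rev_cat big_cat.
by rewrite /= big_seq1 subnKC.
Qed.

(** The word is the cycle sending [i] to [k.-1] and shifting [k - 1, i) up by one. The induction
    peels off the reflection of largest index, which acts first. *)
Lemma pi_eltE r i k (x : 'I_r.+1) : (0 < k <= i.+1)%N -> (i <= r)%N ->
  pi_elt r i k x = (if (x < k.-1)%N then x : nat else if (x < i)%N then x.+1
                    else if x == i :> nat then k.-1 else x) :> nat.
Proof.
elim: i x => [|i IHi] x k_bd i_le.
  by have -> : k = 1%N by [lia]; rewrite pi_elt_id perm1 /=; case: eqP.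
have [le_k|gt_k] := leqP k i.+1; last first.
  have -> : k = i.+2 by lia.
  by rewrite pi_elt_id perm1 /=; case_ifs.
by rewrite pi_eltS // permM IHi ?simple_reflE; case_ifs.
Qed.

(** * Factorization of permutations *)

(** Digits of the factorial number system: [k i] has i + 1 possible values. *)
Definition code r (k : nat -> nat) : Prop :=
  forall i, (i <= r)%N -> (0 < k i <= i.+1)%N.

Definition pi_prod r (k : nat -> nat) m n : 'S_r.+1 :=
  \prod_(m <= i < n) pi_elt r i (k i).

Lemma pi_prod_recr r k m n : (m <= n)%N ->
  pi_prod r k m n.+1 = pi_prod r k m n * pi_elt r n (k n).
Proof. by move=> le_mn; rewrite /pi_prod big_nat_recr. Qed.

Lemma pi_prod_cat r k m n p : (m <= n <= p)%N ->
  pi_prod r k m p = pi_prod r k m n * pi_prod r k n p.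
Proof. by case/andP=> le_mn le_np; rewrite /pi_prod (big_cat_nat le_mn le_np). Qed.

Lemma pi_prod_fix r k m n (x : 'I_r.+1) : code r k -> (n <= x)%N ->
  pi_prod r k m n x = x.
Proof.
move=> ck; have [le_mn|/ltnW gt_mn] := leqP m n; last first.
  by rewrite /pi_prod big_geq // perm1.
elim: n le_mn => [|n IHn]; first by rewrite /pi_prod big_geq // perm1.
rewrite leq_eqVlt => /predU1P[<-|le_mn] lt_nx.
  by rewrite /pi_prod big_geq // perm1.
rewrite pi_prod_recr // permM IHn //; last exact: ltnW.
apply: val_inj => /=.
have := ltn_ord x; have := ck n; rewrite ltnS => kn x_le.
by rewrite pi_eltE; case_ifs.
Qed.

Lemma pi_prod_homo r k m n (x y : 'I_r.+1) : code r k -> (n <= r.+1)%N ->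
  (x < y)%N -> (y < m)%N -> (pi_prod r k m n x < pi_prod r k m n y)%N.
Proof.
move=> ck le_nr lt_xy lt_ym; have [le_mn|/ltnW gt_mn] := leqP m n; last first.
  by rewrite /pi_prod big_geq // !perm1.
(* The bound by [n] is carried along because the factor of index [n] is increasing on the points
   below [n]. *)
suff: (pi_prod r k m n x < pi_prod r k m n y < n)%N by case/andP.
elim: n le_nr le_mn => [|n IHn]; first by lia.
move=> n_lt; rewrite leq_eqVlt ltnS => /predU1P[<-|le_mn].
  by rewrite /pi_prod big_geq // !perm1 lt_xy.
have {}IHn := IHn ltac:(lia) ltac:(lia); have kn := ck n ltac:(lia).
by rewrite pi_prod_recr // !permM !pi_eltE; case_ifs.
Qed.

(** The factors before [x] fix both points. The next two send [y] to k y - 1, and [x] to k x - 1 if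
    k x < k y, to k x otherwise. All later factors preserve the order of these two values. *)
Lemma pi_prod_ltS r k (x y : 'I_r.+1) : code r k -> y = x.+1 :> nat ->
  (pi_prod r k 0 r.+1 x < pi_prod r k 0 r.+1 y)%N = (k x < k y)%N.
Proof.
move=> ck yE; have y_lt := ltn_ord y.
have kx := ck x ltac:(lia); have ky := ck y ltac:(lia).
have splitE : pi_prod r k 0 r.+1 =
    pi_prod r k 0 x * pi_elt r x (k x) * pi_elt r y (k y) * pi_prod r k y.+1 r.+1.
  by rewrite (@pi_prod_cat _ _ 0 y.+1) // (@pi_prod_recr _ _ 0 y) // yE (@pi_prod_recr _ _ 0 x).
rewrite splitE !permM !(@pi_prod_fix _ _ 0) ?yE //.
set a := pi_elt r x.+1 (k x.+1) _; set b := pi_elt r x.+1 (k x.+1) _.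
rewrite yE in ky.
have aE : a = (if (k x < k x.+1)%N then (k x).-1 else k x) :> nat.
  by rewrite /a !pi_eltE; case_ifs.
have bE : b = (k x.+1).-1 :> nat.
  by rewrite /b !pi_eltE; case_ifs.
rewrite -yE in ky aE bE *; move: aE; case: ltnP => k_xy aE.
  by apply: pi_prod_homo => //; lia.
by apply/negbTE; rewrite -leqNgt ltnW //; apply: pi_prod_homo => //; lia.
Qed.

(** Among the factors of index at most [n], only the last can move the point [n], and it sends it to
    k n - 1. This determines the digit [k n]; the factor cancels and the induction continues with
    smaller indices. *)
Lemma pi_prod_inj r k k' : code r k -> code r k' ->
  pi_prod r k 0 r.+1 = pi_prod r k' 0 r.+1 ->
  forall i, (i <= r)%N -> k i = k' i.
Proof.
move=> ck ck'.
suff: forall n, (n <= r.+1)%N -> pi_prod r k 0 n = pi_prod r k' 0 n ->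
    forall i, (i < n)%N -> k i = k' i by move=> H /(H _ (leqnn _)).
elim=> // n IHn lt_nr eq_pr.
have kn := ck n ltac:(lia); have k'n := ck' n ltac:(lia).
have eq_n : k n = k' n.
  have := congr1 (fun w : 'S__ => val (w (inord n))) eq_pr.
  rewrite /= !pi_prod_recr // !permM !pi_prod_fix ?inordK //.
  by rewrite !pi_eltE ?inordK //; case_ifs.
move: eq_pr; rewrite !pi_prod_recr // eq_n => /mulIg eq_pr i.
rewrite ltnS leq_eqVlt => /predU1P[-> //|]; apply: IHn => //; exact: ltnW.
Qed.

Lemma pi_prod_surj r (w : 'S_r.+1) :
  exists2 k, code r k & w = pi_prod r k 0 r.+1.
Proof.
suff fact n : (n <= r.+1)%N ->
    forall w : 'S_r.+1, (forall x : 'I_r.+1, (n <= x)%N -> w x = x) ->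
    exists2 k, code r k & w = pi_prod r k 0 n.
  by apply: fact => // x; have := ltn_ord x; lia.
elim: n => [|n IHn] lt_nr {}w w_fix.
  (* Here [w] is the identity and the product is empty, so any code would do. *)
  exists succn => [i _|]; first by rewrite ltnSn.
  by rewrite /pi_prod big_geq //; apply/permP=> x; rewrite w_fix ?perm1.
(* Points above [n] are fixed by [w], so none of them is the image of [n]. *)
have wn_le : (w (inord n) <= n)%N.
  rewrite leqNgt; apply/negP=> lt_n.
  by have /perm_inj wE := w_fix _ lt_n; move: lt_n; rewrite wE inordK ?ltnn.
set p := pi_elt r n (w (inord n)).+1.
have pn : p (inord n) = w (inord n).
  by apply: val_inj; rewrite /= /p pi_eltE ?inordK //; case_ifs.
(* Dividing by [p] on the right makes [n] a fixed point as well. *)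
have [x le_nx|k ck wE] := IHn (ltnW lt_nr) (w * p^-1).
  rewrite permM; apply: (@perm_inj _ p); rewrite permKV.
  move: le_nx; rewrite leq_eqVlt => /predU1P[nE|lt_nx].
    by rewrite -(inord_val x) -nE pn.
  by rewrite w_fix //; apply: val_inj; rewrite /= /p pi_eltE //; have := ltn_ord x; case_ifs.
exists (fun i => if i == n then (w (inord n)).+1 else k i) => [i le_i|].
  by case: eqP => [->|_]; [lia | exact: ck].
rewrite pi_prod_recr // eqxx -/p; apply: (mulIg p^-1); rewrite mulgK wE.
by apply: eq_big_nat => i /andP[_ lt_in]; rewrite ltn_eqF.
Qed.

(** * Blocks *)

Lemma col_start_leq rs i j : (i <= j)%N -> (col_start rs i <= col_start rs j)%N.
Proof.
move=> le_ij; rewrite /col_start -(subnKC le_ij) takeD sumn_cat.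
exact: leq_addr.
Qed.

Lemma same_blockP rs p q :
  reflect (exists2 j, (j < size rs)%N &
            (col_start rs j <= p < col_start rs j.+1)%N
            /\ (col_start rs j <= q < col_start rs j.+1)%N)
          (same_block rs p q).
Proof.
apply: (iffP existsP) => [[j /andP[jp jq]]|[j lt_j [jp jq]]]; first by exists j.
by exists (Ordinal lt_j); rewrite jp jq.
Qed.

Lemma same_block_sym rs p q : same_block rs p q = same_block rs q p.
Proof. by apply: eq_existsb => j; rewrite andbC. Qed.

Lemma same_block_trans rs : transitive (same_block rs).
Proof.
move=> q p s /same_blockP[j lt_j [jp jq]] /same_blockP[i lt_i [iq is_]].
have [lt_ij|lt_ji|eq_ij] := ltngtP i j; last first.
- by apply/same_blockP; exists j => //; split=> //; rewrite -eq_ij.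
- by have := col_start_leq rs lt_ji; lia.
- by have := col_start_leq rs lt_ij; lia.
Qed.

Lemma same_block_between rs p q s : (p <= q <= s)%N ->
  same_block rs p s -> same_block rs p q && same_block rs q s.
Proof.
move=> pqs /same_blockP[j lt_j [jp js]].
by apply/andP; split; apply/same_blockP; exists j => //; lia.
Qed.

(** The block of [p] is the first one that ends beyond [p]. *)
Lemma same_block_refl rs p : (p < sumn rs)%N -> same_block rs p p.
Proof.
move=> lt_p; suff [j lt_j jp] : exists2 j, (j < size rs)%N &
    (col_start rs j <= p < col_start rs j.+1)%N by apply/same_blockP; exists j.
have ex_j : exists j, (p < col_start rs j.+1)%N.
  by exists (size rs); rewrite /col_start take_oversize // ltnW.
have [j lt_p_j min_j] := ex_minnP ex_j.
have le_jp : (col_start rs j <= p)%N.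
  case: j lt_p_j min_j => [|j] _ min_j; first by rewrite /col_start take0.
  by rewrite leqNgt; apply/negP => /min_j; rewrite ltnn.
exists j; last by rewrite le_jp.
rewrite ltnNge; apply/negP=> le_j; move: le_jp.
by rewrite /col_start take_oversize // leqNgt lt_p.
Qed.

(** For a partition of r + 1, these are the minimal-length representatives of the cosets W(P)w,
    described without a length function. *)
Definition block_increasing r rs (w : 'S_r.+1) : Prop :=
  forall x y : 'I_r.+1, (x < y)%N -> same_block rs x y -> (w x < w y)%N.

(** Blocks are intervals, so the points between [x] and [y] share their block and the inequalities
    chain. *)
Lemma block_increasingS r rs (w : 'S_r.+1) :
  (forall x y : 'I_r.+1, y = x.+1 :> nat -> same_block rs x y -> (w x < w y)%N) ->
  block_increasing rs w.
Proof.
move=> w_incr x y; have [n] := ubnP (y : nat).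
elim: n y => // n IHn y lt_yn lt_xy xy.
have y_lt := ltn_ord y; have zE : (inord y.-1 : 'I_r.+1) = y.-1 :> nat.
  by rewrite inordK //; lia.
have /andP[xz zy] : same_block rs x (inord y.-1 : 'I_r.+1)
                    && same_block rs (inord y.-1 : 'I_r.+1) y.
  by apply: same_block_between => //; lia.
have w_zy := w_incr (inord y.-1) y ltac:(lia) zy.
have [eq_xz|ne_xz] := eqVneq x (inord y.-1); first by rewrite eq_xz.
apply: ltn_trans w_zy; apply: IHn => //; try lia.
by move: ne_xz; rewrite -val_eqE /= zE; lia.
Qed.

(** The permutations that keep every point in its block form a group containing the generators. *)
Lemma weyl_P_same_block r rs (u : 'S_r.+1) (x : 'I_r.+1) :
  sumn rs = r.+1 -> u \in weyl_P r rs -> same_block rs x (u x).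
Proof.
move=> sum_rs; have bl_refl (y : 'I_r.+1) : same_block rs y y.
  by apply: same_block_refl; rewrite sum_rs.
pose B := [set v : 'S_r.+1 | [forall y : 'I_r.+1, same_block rs y (v y)]].
have gB : group_set B.
  apply/group_setP; split=> [|v1 v2]; first by rewrite inE; apply/forallP=> y; rewrite perm1.
  rewrite !inE => /forallP Bv1 /forallP Bv2; apply/forallP=> y.
  by rewrite permM (same_block_trans (Bv1 y)).
suff /subsetP sPB : weyl_P r rs \subset Group gB.
  by move=> /sPB; rewrite inE => /forallP.
rewrite gen_subG; apply/subsetP=> _ /imsetP[i /[!inE] /andP[i_gt0 bl_i] ->].
apply/forallP=> y; have i_lt := ltn_ord i.
rewrite simple_reflE; last by lia.
case: eqP => [-> //|_]; case: eqP => [->|_] //; by rewrite same_block_sym.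
Qed.

(* The increasing representative maximizes [\sum_x x * v x] on its coset. *)
Lemma weyl_coset_block_increasing r rs (w : 'S_r.+1) :
  exists2 v, v \in weyl_P r rs :* w & block_increasing rs v.
Proof.
pose f (v : 'S_r.+1) := \sum_(x : 'I_r.+1) (x * v x)%N.
have [v Pv max_v] := arg_maxnP f (rcoset_refl (weyl_P r rs) w).
exists v => //; apply: block_increasingS => x y yE bl_xy.
have y_lt := ltn_ord y.
have ne_yx : y != x by rewrite -val_eqE /= yE gtn_eqF.
rewrite ltn_neqAle (inj_eq val_inj) (inj_eq perm_inj) eq_sym ne_yx.
rewrite leqNgt; apply/negP=> lt_vyx.
have sE : simple_refl r y = tperm x y.
  by rewrite /simple_refl yE /= inord_val -yE inord_val.
have Ps : tperm x y \in weyl_P r rs.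
  by rewrite -sE mem_gen //; apply/imsetP; exists y; rewrite // inE yE /= -yE bl_xy.
have : tperm x y * v \in weyl_P r rs :* w.
  by rewrite mem_rcoset -mulgA groupM // -mem_rcoset; exact: Pv.
have fE u : (f u = x * u x + (y * u y + \sum_(i | (i != x) && (i != y)) i * u i))%N.
  by rewrite /f (bigD1 x) // (bigD1 y).
move/max_v; rewrite !fE !permM tpermL tpermR.
have -> : (\sum_(i | (i != x) && (i != y)) i * (tperm x y * v)%g i =
           \sum_(i | (i != x) && (i != y)) i * v i)%N.
  by apply: eq_bigr => i /andP[ix iy]; rewrite permM tpermD // eq_sym.
(* As y = x + 1, the transposition would raise [f] by v x - v y > 0, against maximality. *)
rewrite yE; nia.
Qed.

(** Let [v] be [u] followed by [w]. If [x] is the least point moved by [u], then u x and z = u^-1 x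
    lie above [x] in its block. Monotonicity of [w] gives w x < w (u x), while v x < v z says w (u
    x) < w x. *)
Lemma block_increasing_inj r rs (v w : 'S_r.+1) : sumn rs = r.+1 ->
  block_increasing rs v -> block_increasing rs w ->
  v \in weyl_P r rs :* w -> v = w.
Proof.
move=> sum_rs v_incr w_incr /rcosetP[u Pu vE].
suff u1 : u = 1 by rewrite vE u1 mul1g.
have bl_u x := weyl_P_same_block x sum_rs Pu.
apply/permP=> x; rewrite perm1; have [n] := ubnP (x : nat).
elim: n x => // n IHn x lt_xn; have [ux|xu|/val_inj //] := ltngtP (u x) x.
  have /perm_inj uE : u (u x) = u x by apply: IHn; lia.
  by rewrite uE.
pose z := u^-1 x; have uz : u z = x by rewrite permKV.
have lt_xz : (x < z)%N.
  rewrite ltnNge leq_eqVlt; apply/negP => /orP[/eqP/val_inj zx|lt_zx].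
    by move: xu; rewrite -{1}uz zx ltnn.
  by have := IHn z ltac:(lia); rewrite uz => xz; move: lt_zx; rewrite xz ltnn.
have bl_xz : same_block rs x z by rewrite same_block_sym -[in X in same_block _ _ X]uz.
have := v_incr x z lt_xz bl_xz; rewrite vE !permM uz ltnNge => /negP[].
by rewrite ltnW // w_incr.
Qed.

(** * Tableaux *)

(* The deleted first column is restored with its only possible entries. *)
Definition tableau_code r rs (k : filling r rs) (i : nat) : nat :=
  if (i < head 0 rs)%N then i.+1 else entry k i.

Lemma col_start1 rs : col_start rs 1 = head 0%N rs.
Proof. by case: rs => //= n rs; rewrite /col_start /= take0 addn0. Qed.

(** Columns are consecutive ranges of indices, so their products concatenate; the restored first
    column contributes only trivial factors. *)
Lemma tableau_prodE r rs (k : filling r rs) :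
  general_partition r.+1 rs ->
  tableau_prod k = pi_prod r (tableau_code k) 0 r.+1.
Proof.
case/andP=> _ /eqP sum_rs.
have size_gt0 : (0 < size rs)%N by case: rs sum_rs k.
have partE n : (0 < n <= size rs)%N -> \prod_(1 <= j < n) col_prod k j =
    pi_prod r (tableau_code k) (col_start rs 1) (col_start rs n).
  elim: n => // n IHn; case: n IHn => [|n] IHn lt_n.
    by rewrite /pi_prod !big_geq.
  rewrite big_nat_recr // IHn ?(ltnW lt_n) //=.
  rewrite [RHS](@pi_prod_cat _ _ _ (col_start rs n.+1)) ?col_start_leq //; congr (_ * _).
  apply: eq_big_nat => i /andP[le_i _]; rewrite /tableau_code ltnNge.
  by rewrite (leq_trans _ le_i) // -col_start1 col_start_leq.
have lastE : col_start rs (size rs) = r.+1 by rewrite /col_start take_size.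
rewrite /tableau_prod partE ?size_gt0 //= lastE.
rewrite [RHS](@pi_prod_cat _ _ _ (col_start rs 1)).
  rewrite [X in X * _]/pi_prod big_nat_cond big1 ?mul1g // => i /andP[/andP[_ lt_i] _].
  by rewrite /tableau_code -col_start1 lt_i pi_elt_id.
by rewrite -lastE col_start_leq.
Qed.

(** Sortedness of columns becomes a comparison of consecutive indices in a block, the form that
    [pi_prod_ltS] translates to permutations. In the first block it holds automatically. *)
Lemma is_tableauP r rs (k : filling r rs) :
  sumn rs = r.+1 ->
  reflect (code r (tableau_code k) /\
           forall x y : 'I_r.+1, y = x.+1 :> nat -> same_block rs x y ->
             (tableau_code k x < tableau_code k y)%N)
          (is_tableau k).
Proof.
move=> sum_rs; rewrite /is_tableau.
have colP j : reflect (forall i, (col_start rs j <= i)%N ->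
      (i.+1 < col_start rs j.+1)%N -> (entry k i < entry k i.+1)%N)
    (sorted ltn (column k j)).
  apply: (iffP (sortedP 0%N)); rewrite size_map size_iota => H i.
    move=> le_i lt_i; have := H (i - col_start rs j)%N ltac:(lia).
    rewrite !(nth_map 0%N) ?size_iota; try lia.
    by rewrite !nth_iota ?addnS ?subnKC //; lia.
  move=> lt_i; rewrite !(nth_map 0%N) ?size_iota; try lia.
  by rewrite !nth_iota ?addnS; try lia; apply: H; lia.
apply: (iffP andP) => [[/forallP bd /forallP cols]|[ck incr]].
  split=> [i le_ir|x y yE /same_blockP[j lt_j [jx jy]]].
    rewrite /tableau_code; case: (ltnP i (head 0 rs)) => [_|le_i]; first by rewrite ltnSn.
    exact: (implyP (bd (Ordinal (le_ir : (i < r.+1)%N)))).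
  rewrite /tableau_code yE; case: j lt_j jx jy => [|j] lt_j jx jy.
    by move: jx jy; rewrite col_start1 /col_start take0 /= yE => -> ->.
  have := col_start_leq rs (isT : (1 <= j.+1)%N); rewrite col_start1 => le_j.
  rewrite !ifF; try lia.
  by apply: (colP j.+1 (implyP (cols (Ordinal lt_j)) isT)); lia.
split; apply/forallP=> j; apply/implyP=> j_ge.
  have := ck j (ltn_ord j); rewrite /tableau_code ifF //; lia.
apply/colP => i le_i lt_i.
have := col_start_leq rs j_ge; rewrite col_start1 => le_j.
have i_lt : (i.+1 < r.+1)%N.
  apply: leq_trans lt_i _; rewrite -sum_rs -[X in (_ <= sumn X)%N](cat_take_drop j.+1 rs).
  by rewrite sumn_cat leq_addr.
have := incr (Ordinal (ltnW i_lt)) (Ordinal i_lt) erefl.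
rewrite /tableau_code /= !ifF; try lia.
by apply; apply/same_blockP; exists j => //; lia.
Qed.

Lemma tableau_prod_incr r rs (k : filling r rs) :
  general_partition r.+1 rs -> is_tableau k ->
  block_increasing rs (tableau_prod k).
Proof.
move=> rsP; have /andP[_ /eqP sum_rs] := rsP.
move=> /(is_tableauP _ sum_rs)[ck incr]; apply: block_increasingS => x y yE bl_xy.
by rewrite tableau_prodE // pi_prod_ltS //; apply: incr.
Qed.

(** * Bijectivity of the map from tableaux to cosets *)

Lemma tableau_coset_inj r rs :
  general_partition r.+1 rs -> injective (@tableau_coset r rs).
Proof.
move=> rsP; have /andP[_ /eqP sum_rs] := rsP.
move=> [k Tk] [k' Tk'] /(congr1 val) /= eq_coset.
have := rcoset_refl (weyl_P r rs) (tableau_prod k); rewrite eq_coset => Pk.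
(* Both products are increasing representatives of one coset, hence equal. *)
have := block_increasing_inj sum_rs (tableau_prod_incr rsP Tk)
                             (tableau_prod_incr rsP Tk') Pk.
have [ck _] := is_tableauP k sum_rs Tk; have [ck' _] := is_tableauP k' sum_rs Tk'.
rewrite !tableau_prodE // => /(pi_prod_inj ck ck') eq_code.
apply: val_inj => /=; apply: (@eq_from_tnth _ _ k k') => i.
(* Position [i] of the tuple holds the entry of index i + r_1. *)
have i_lt := ltn_ord i; have := eq_code (i + head 0 rs)%N ltac:(lia).
by rewrite /tableau_code !ifF ?/entry ?addnK -?tnth_nth //; lia.
Qed.

(** The code of the increasing representative, with its first column dropped, is the required
    tableau. *)
Lemma tableau_coset_surj r rs (C : weyl_cosets r rs) :
  general_partition r.+1 rs -> exists k, tableau_coset k = C.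
Proof.
move=> rsP; have /andP[rs_gt0 /eqP sum_rs] := rsP.
case: C => C CP; have /rcosetsP[w _ CE] := CP.
have [v] := weyl_coset_block_increasing rs w; rewrite -CE => Cv v_incr.
have [k ck vE] := pi_prod_surj v.
have incr (x y : 'I_r.+1) : y = x.+1 :> nat -> same_block rs x y -> (k x < k y)%N.
  by move=> yE bl; rewrite -pi_prod_ltS // -vE; apply: v_incr => //; rewrite yE.
have head_le : (head 0 rs <= r.+1)%N.
  by rewrite -sum_rs; case: (rs) => //= n s; apply: leq_addr.
(* The bounds force k_0 = 1; then k_(i+1) exceeds k_i = i + 1 and is at most i + 2. *)
have first_col i : (i < head 0 rs)%N -> k i = i.+1.
  elim: i => [|i IHi] lt_i; first by have := ck 0%N isT; lia.
  have i_lt : (i.+1 < r.+1)%N by lia.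
  have := incr (Ordinal (ltnW i_lt)) (Ordinal i_lt) erefl; rewrite /= IHi ?(ltnW lt_i) //.
  have := ck i.+1 i_lt; move=> k_bd; have -> : same_block rs i i.+1; last by move/(_ isT); lia.
  apply/same_blockP; exists 0%N; first by case: (rs) lt_i.
  by rewrite col_start1 /col_start take0 /=; lia.
pose t : filling r rs := [tuple k (i + head 0 rs)%N | i < r.+1 - head 0 rs].
have codeE i : (i <= r)%N -> tableau_code t i = k i.
  move=> le_i; rewrite /tableau_code; case: ltnP => [/first_col // |ge_i].
  have lt_i : (i - head 0 rs < r.+1 - head 0 rs)%N by lia.
  by rewrite /entry -[(i - _)%N]/(val (Ordinal lt_i)) -tnth_nth tnth_mktuple /= subnK.
have Tt : is_tableau t.
  apply/is_tableauP => //; split=> [i le_i|x y yE bl]; first by rewrite codeE // ck.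
  by rewrite !codeE ?incr //; rewrite -ltnS.
have tE : tableau_prod t = v.
  rewrite tableau_prodE // vE; apply: eq_big_nat => i /andP[_ lt_i].
  by rewrite codeE.
exists (exist _ t Tt); apply: val_inj => /=; rewrite tE CE.
by apply: rcoset_eqP; rewrite -CE.
Qed.

Theorem theorem2p4 (r : nat) (rs : seq nat) :
  general_partition r.+1 rs -> bijective (@tableau_coset r rs).
Proof.
move=> rsP; have inj := tableau_coset_inj rsP.
(* Boolean equality of cosets lets [xchoose] select preimages, which gives the inverse map. *)
have surj C : exists k, @tableau_coset r rs k == C.
  by have [k <-] := tableau_coset_surj C rsP; exists k.
have can C : tableau_coset (xchoose (surj C)) = C := eqP (xchooseP (surj C)).
by exists (fun C => xchoose (surj C)) => // k; apply: inj; rewrite can.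
Qed.
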